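(* Let $0<\alpha<1$, $1<p<\frac1\alpha$ and $\frac1q=\frac1p-\alpha$. If $\omega\in\mathcal{A}(p,q)$, then there exists a positive constant $C$, independent of $x$, such that for every $x\in l^p_{\omega^p}$ one has $\mathcal{M}_\alpha x\in l^q_{\omega^q}$ and $$\|\mathcal{M}_\alpha x\|_{l^q_{\omega^q}}\le C\|x\|_{l^p_{\omega^p}}.$$
   Context: Sequences are real, $x=\{x(k)\}_{k\in\mathbb{Z}}\subset\mathbb{R}$. $\mathbb{N}=\{0,1,2,\dots\}$. For $m\in\mathbb{Z}$, $N\in\mathbb{N}$, $S_{m,N}:=\{k\in\mathbb{Z}:|k-m|\le N\}$; $|A|$ denotes cardinality. A discrete weight is a sequence $\omega=\{\omega(k)\}_{k\in\mathbb{Z}}$ of positive reals; powers $\omega^r$ are taken pointwise. For a weight $v$ and $1\le p<\infty$, $l^p_v$ is the space of sequences with $\|x\|_{l^p_v}:=\big(\sum_{k\in\mathbb{Z}}|x(k)|^pv(k)\big)^{1/p}<\infty$. An interval $J\subset\mathbb{Z}$ is a finite nonempty set of consecutive integers. For $1<p,q<\infty$ and $p'=p/(p-1)$, $\omega\in\mathcal{A}(p,q)$ means $$\sup_{J}\Big(\frac1{|J|}\sum_{k\in J}\omega(k)^q\Big)^{\frac1q}\Big(\frac1{|J|}\sum_{k\in J}\omega(k)^{-p'}\Big)^{\frac1{p'}}<\infty,$$ the supremum being over all intervals $J\subset\mathbb{Z}$. Discrete fractional maximal operator: $\mathcal{M}_\alpha x(m):=\sup_{N\in\mathbb{N}}\frac{1}{|S_{m,N}|^{1-\alpha}}\sum_{k\in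 S_{m,N}}|x(k)|$, $m\in\mathbb{Z}$. *)

(* Defs.v *)
From mathcomp Require Import all_boot all_order all_algebra.
From mathcomp Require Import finmap.
From mathcomp Require Import all_classical all_reals all_analysis.
Import Order.TTheory GRing.Theory Num.Theory.
Set Implicit Arguments.
Unset Strict Implicit.
Unset Printing Implicit Defensive.
Local Open Scope classical_set_scope.
Local Open Scope ring_scope.

Definition weight (R : realType) (w : int -> R) : Prop := forall k, 0 < w k.

Definition weight_pow (R : realType) (w : int -> R) (r : R) : int -> R :=
  fun k => w k `^ r.

(* Extended-real valued, so that it is [+oo] exactly off the space [lp p v]. *)
Definition lp_norm (R : realType) (p : R) (v : int -> R) (x : int -> R)
    : \bar R :=
  ((\esum_(k in [set: int]) (`|x k| `^ p * v k)%:E) `^ p^-1)%E.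

Definition lp (R : realType) (p : R) (v : int -> R) : set (int -> R) :=
  [set x | (lp_norm p v x < +oo)%E].

Definition card_set (A : set int) : nat := #|` fset_set A |.

Definition int_interval : set (set int) :=
  [set J | exists a b : int, a <= b /\ J = [set k | a <= k <= b]].

Definition average (R : realType) (J : set int) (f : int -> R) : R :=
  (card_set J)%:R^-1 * \sum_(k \in J) f k.

Definition conj_exp (R : realType) (p : R) : R := p / (p - 1).

Definition A_class (R : realType) (p q : R) : set (int -> R) :=
  [set w | (ereal_sup
    [set ((average J (weight_pow w q)) `^ q^-1 *
          (average J (weight_pow w (- conj_exp p))) `^ (conj_exp p)^-1)%:E
    | J in int_interval] < +oo)%E].

Definition ball_int (m : int) (N : nat) : set int :=
  [set k | `|k - m| <= N%:Z].

(* The supremum may be infinite for a general sequence [x]. *)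
Definition frac_max (R : realType) (alpha : R) (x : int -> R) (m : int)
    : \bar R :=
  ereal_sup (range (fun N : nat =>
    (((card_set (ball_int m N))%:R `^ (1 - alpha))^-1 *
     \sum_(k \in ball_int m N) `|x k|)%:E)).

(* Main.v *)
Require Import Defs.
From mathcomp Require Import all_boot all_order all_algebra.
From mathcomp Require Import finmap.
From mathcomp Require Import all_classical all_reals all_analysis.
From mathcomp Require Import ring lra zify.

(** Write [u = w^q], [s = w^(-p')], [c = p'], [a = 1 + c / q] and
    [<f>_(s,S)] for the [s]-weighted mean of [f] over [S].  Reverse Hoelder is
    avoided by comparing with two maximal functions for general measures,
    following Lerner's proof of Muckenhoupt's theorem.  Put [f = |x| / s], let
    [g] dominate all means [<f>_(s,S)] over intervals [S] through the point, put
    [h = g^(p/a) / u], and let [H] dominate all means [<h>_(u,S)].  Averaging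
    [<f>_(s,S)^(p/a) <= g^(p/a)] over [S] and using the A(p,q) bound gives
      [|S|^(alpha-1) sum_S |x| <= K^c (u(S) <h>_(u,S)^a)^alpha <h>_(u,S)^(a/q)],
    whose right-hand side is at most [K^c (sum H^a u)^alpha H^(a/q)].  The strong
    type of the two maximal functions bounds [sum H^a u] by
    [sum h^a u = sum g^p s], hence by [sum f^p s = sum |x|^p w^p].  On the line,
    uncentered weighted maximal functions are of strong type with constants
    independent of the measure, by the maximal ergodic lemma on either side. *)

Import Order.TTheory GRing.Theory Num.Theory.
Local Open Scope classical_set_scope.
Local Open Scope ring_scope.

(** * Maximal ergodic lemma and the one-sided weak-type inequality *)

(** Recursive form of the largest sum of [d] over a block [[j, n)] with [j <= n], the empty block
    included. *)
Fixpoint excess (R : realType) (d : nat -> R) (n : nat) : R :=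
  if n is k.+1 then Num.max 0 (excess R d k + d k) else 0.

Lemma excess_ge0 (R : realType) (d : nat -> R) n : 0 <= excess R d n.
Proof. by case: n => [|n] //=; rewrite le_max lexx. Qed.

(** At a selected index the excess grows by exactly [d i]; at any other it drops to 0 from a
    nonnegative value. With [excess_ge0] this makes the selected sum nonnegative, which is the
    maximal ergodic lemma. *)
Lemma excess_le_sum (R : realType) (d : nat -> R) n :
  excess R d n <= \sum_(0 <= i < n | 0 <= excess R d i + d i) d i.
Proof.
elim: n => [|n IHn] /=; first by rewrite big_nil.
rewrite big_mkcond big_nat_recr //= -big_mkcond /=.
have [h|h] := leP 0 (excess R d n + d n).
  by rewrite lerD2r.
by rewrite addr0 (le_trans _ IHn) // excess_ge0.
Qed.

Lemma sum_le_excess (R : realType) (d : nat -> R) i j : (j <= i)%N ->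
  \sum_(j <= k < i.+1) d k <= excess R d i + d i.
Proof.
elim: i j => [|i IHi] j.
  by rewrite leqn0 => /eqP->; rewrite big_nat1 /= add0r.
rewrite leq_eqVlt => /orP[/eqP->|ji].
  by rewrite big_nat1 lerDr excess_ge0.
rewrite big_nat_recr //=; last exact: leqW.
by rewrite lerD2r le_max IHi // orbT.
Qed.

(** Together with [sum_le_excess], this identifies [excess R d i + d i] as the maximum over nonempty
    blocks ending at [i]. An optimal block is extended while the running value is nonnegative and
    restarted otherwise. *)
Lemma excess_attained (R : realType) (d : nat -> R) i :
  exists2 j, (j <= i)%N & \sum_(j <= k < i.+1) d k = excess R d i + d i.
Proof.
elim: i => [|i [j ji IHi]]; first by exists 0 => //; rewrite big_nat1 /= add0r.
have [h|h] := leP 0 (excess R d i + d i).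
  exists j; first exact: leqW.
  by rewrite big_nat_recr /= ?IHi ?leqW //; congr (_ + _); apply/esym/max_idPr.
by exists i.+1 => //; rewrite big_nat1 /= (max_idPl (ltW h)) add0r.
Qed.

Lemma sum_nat_gt0 (R : realType) (mu : nat -> R) a b : (forall k, 0 < mu k) ->
  (a < b)%N -> 0 < \sum_(a <= k < b) mu k.
Proof.
move=> mu0 ab; rewrite big_ltn // ltr_wpDr // sumr_ge0 // => k _.
exact: ltW.
Qed.

(* The maximal ergodic lemma applied to the signed sequence [(f - t) mu]. *)
Lemma backward_weak_type (R : realType) (mu f M : nat -> R) n (t : R) :
  (forall k, 0 < mu k) ->
  (forall i j, (j <= i)%N ->
     \sum_(j <= k < i.+1) f k * mu k <= M i * \sum_(j <= k < i.+1) mu k) ->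
  (forall i, exists2 j, (j <= i)%N &
     \sum_(j <= k < i.+1) f k * mu k = M i * \sum_(j <= k < i.+1) mu k) ->
  0 <= \sum_(0 <= i < n | t <= M i) (f i - t) * mu i.
Proof.
move=> mu0 Mub Matt; pose d k := (f k - t) * mu k.
have sumd j i : \sum_(j <= k < i) d k =
    \sum_(j <= k < i) f k * mu k - t * \sum_(j <= k < i) mu k.
  by rewrite mulr_sumr -sumrB; apply: eq_bigr => k _; rewrite /d mulrBl.
(* The two selections agree: since [M i] is the largest mean over blocks ending at [i], [t <= M i]
   holds iff some such block has a nonnegative sum of [d]. *)
rewrite (eq_bigl (fun i => 0 <= excess R d i + d i)).
  exact: le_trans (excess_ge0 _ _ _) (excess_le_sum _ _ n).
move=> i; apply/idP/idP => [tM|].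
  have [j ji E] := Matt i; apply: le_trans (sum_le_excess R d i j ji).
  by rewrite sumd E subr_ge0 ler_pM2r // sum_nat_gt0.
have [j ji <-] := excess_attained R d i.
rewrite sumd subr_ge0 => /le_trans/(_ (Mub _ _ ji)).
by rewrite ler_pM2r // sum_nat_gt0.
Qed.

(** * From weak type to strong type on a finite index set *)

Lemma conj_exp_props (R : realType) (p : R) : 1 < p ->
  [/\ 1 < conj_exp p, p^-1 + (conj_exp p)^-1 = 1 &
      (p - 1) * conj_exp p = p].
Proof.
move=> p1; rewrite /conj_exp.
have pn : p != 0 by apply/eqP => h; lra.
have p1n : p - 1 != 0 by apply/eqP => h; lra.
by split; [rewrite ltr_pdivlMr; lra | field; apply/andP | field].
Qed.

Lemma young_powR (R : realType) (p a b : R) : 1 < p -> 0 <= a -> 0 <= b ->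
  a * b `^ (p - 1) <= a `^ p / p + b `^ p / conj_exp p.
Proof.
move=> p1 a0 b0; have [c1 pc pc1] := conj_exp_props R p p1.
rewrite -[X in b `^ X / _]pc1 powRrM.
by apply: conjugate_powR => //; rewrite ?powR_ge0 //; lra.
Qed.

(* Layer-cake integration of the weak-type inequality against
   [d (t ^ (p - 1))], done one value of [M] at a time. *)
Lemma lp_le_of_weak_type (R : realType) (I : finType) (p : R) (mu f M : I -> R) :
  1 < p -> (forall k, 0 < mu k) -> (forall k, 0 <= M k) ->
  (forall t, 0 <= \sum_(i | t <= M i) (f i - t) * mu i) ->
  \sum_i M i `^ p * mu i <= conj_exp p * \sum_i f i * M i `^ (p - 1) * mu i.
Proof.
move=> p1 mu0 M0 weak; have [c1 pc _] := conj_exp_props R p p1.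
have young := young_powR R p _ _ p1.
set c := conj_exp p in c1 pc young *.
(* For [t < M i], [F t i] is the integral of [(f i - r) * mu i] against [d (r ^ (p - 1))] for [r]
   from [t] to [M i]; here [1 / c = (p - 1) / p]. *)
pose F t i := (f i * (M i `^ (p - 1) - t `^ (p - 1)) -
               (M i `^ p - t `^ p) / c) * mu i.
suff H t : 0 <= t -> 0 <= \sum_(i | t < M i) F t i.
  have := H 0 (lexx _).
  rewrite (_ : \sum_(i | _) F 0 i = \sum_i F 0 i); last first.
    rewrite big_mkcond; apply: eq_bigr => i _; case: ifPn => //.
    rewrite -leNgt => h; have M00 : M i = 0 by apply/eqP; rewrite eq_le h M0.
    by rewrite /F M00 !subrr mulr0 mul0r subrr mul0r.
  rewrite (_ : \sum_i F 0 i = \sum_i f i * M i `^ (p - 1) * mu i -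
    c^-1 * \sum_i M i `^ p * mu i); last first.
    rewrite mulr_sumr -sumrB; apply: eq_bigr => i _.
    by rewrite /F !powR0; [rewrite !subr0; ring | apply/eqP => h; lra..].
  by rewrite subr_ge0 mulrC ler_pdivrMr 1?[X in _ <= X]mulrC //; lra.
have [k] := ubnP #|[pred i | t < M i]|.
elim: k t => // k IHk t kt t0.
have [i0 ti0|noM] := pickP [pred i | t < M i]; last by rewrite big_pred0.
(* Let [s] be the least value of [M] above [t]. No value lies strictly between, so the level set is
   constant on this slice, and fewer indices remain above [s]. *)
case: (@arg_minP _ _ _ i0 (fun i => t < M i) M ti0) => i1 ti1 i1min.
set s := M i1 in ti1 i1min.
have s0 : 0 <= s by exact: M0.
have ts i : (t < M i) = (s <= M i).
  by apply/idP/idP => [|sM]; [exact: i1min | exact: lt_le_trans sM].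
have IHs : 0 <= \sum_(i | s < M i) F s i.
  apply: IHk => //; apply: leq_trans (kt : (_ <= k)%N).
  apply: proper_card; apply/properP; split; first apply/fintype.subsetP => i.
    by rewrite !inE; exact: lt_trans.
  by exists i1; rewrite !inE // /s ltxx.
rewrite (eq_bigl _ _ ts).
rewrite (_ : \sum_(i | s <= M i) F t i = \sum_(i | s < M i) F s i +
  \sum_(i | s <= M i) (F t i - F s i)); last first.
  rewrite sumrB (_ : \sum_(i | s < M i) F s i = \sum_(i | s <= M i) F s i).
    by ring.
  rewrite big_mkcond [RHS]big_mkcond; apply: eq_bigr => i _.
  rewrite le_eqVlt; have [//|_] := ltP s (M i); first by rewrite orbT.
  rewrite orbF; case: eqP => // sE; rewrite /F -sE !subrr mulr0 mul0r subrr.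
  by rewrite mul0r.
apply: addr_ge0 => //.
(* The slice from [t] to [s] is bounded below using the weak-type inequality at its top level [s];
   the discrepancy has the right sign by Young's inequality for [s * t ^ (p - 1)]. *)
have st : 0 <= s `^ (p - 1) - t `^ (p - 1).
  by rewrite subr_ge0 ge0_ler_powR ?nnegrE //; [lra | exact: ltW].
apply: le_trans (mulr_ge0 st (weak s)) _.
rewrite mulr_sumr; apply: ler_sum => i _.
rewrite /F -mulrBl mulrA ler_pM2r //.
have := young s t s0 t0.
have sE : s * s `^ (p - 1) = s `^ p by rewrite mulr_powRB1 //; lra.
have pcE : s `^ p / p = s `^ p - s `^ p / c.
  by rewrite -[X in _ = X - _]mulr1 -pc; ring.
nra.
Qed.

(** Young's inequality applied to [(c * f i) * M i ^ (p - 1)] leaves the fraction [1 / c] of the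
    left side on the right. The sums are finite, so it can be absorbed, and [1 - 1 / c = 1 / p]. *)
Lemma maximal_lp (R : realType) (I : finType) (p : R) (mu f M : I -> R) :
  1 < p -> (forall k, 0 < mu k) -> (forall k, 0 <= f k) ->
  (forall k, 0 <= M k) ->
  (forall t, 0 <= \sum_(i | t <= M i) (f i - t) * mu i) ->
  \sum_i M i `^ p * mu i <= conj_exp p `^ p * \sum_i f i `^ p * mu i.
Proof.
move=> p1 mu0 f0 M0 /(lp_le_of_weak_type R I p mu f M p1 mu0 M0).
have [c1 pc _] := conj_exp_props R p p1.
have young := young_powR R p _ _ p1.
set c := conj_exp p in c1 pc young *; move=> H.
have p0 : 0 < p by lra.
have c0 : 0 <= c by lra.
have : c * \sum_i f i * M i `^ (p - 1) * mu i <=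
    (c `^ p * \sum_i f i `^ p * mu i) / p + (\sum_i M i `^ p * mu i) / c.
  rewrite !mulr_sumr !mulr_suml -big_split /=; apply: ler_sum => i _.
  have := young (c * f i) (M i) (mulr_ge0 c0 (f0 i)) (M0 i).
  rewrite powRM // => h; have := mu0 i; nra.
move=> /(le_trans H).
have -> : c^-1 = 1 - p^-1 by lra.
rewrite mulrBr mulr1 -subr_ge0 => h.
have : 0 <= (c `^ p * (\sum_i f i `^ p * mu i) - \sum_i M i `^ p * mu i) / p.
  by apply: le_trans h _; rewrite le_eqVlt; apply/orP; left; apply/eqP; ring.
by rewrite pmulr_lge0 ?invr_gt0 // subr_ge0.
Qed.

(** * Weighted maximal functions on a finite window, one-sided and then uncentered *)

(** [M i] is the largest mean over blocks ending at [i]. There are finitely many, so the maximum is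
    attained, as [backward_weak_type] requires. *)
Lemma backward_maximal (R : realType) (p : R) (mu f : nat -> R) (n : nat) :
  1 < p -> (forall k, 0 < mu k) -> (forall k, 0 <= f k) ->
  exists M : nat -> R, [/\ forall i, 0 <= M i,
    forall i j, (j <= i)%N ->
      \sum_(j <= k < i.+1) f k * mu k <= M i * \sum_(j <= k < i.+1) mu k &
    \sum_(0 <= i < n) M i `^ p * mu i <=
      conj_exp p `^ p * \sum_(0 <= i < n) f i `^ p * mu i].
Proof.
move=> p1 mu0 f0.
pose r i j := (\sum_(j <= k < i.+1) f k * mu k) / \sum_(j <= k < i.+1) mu k.
have mus i j : (j <= i)%N -> 0 < \sum_(j <= k < i.+1) mu k.
  by move=> ji; apply: sum_nat_gt0.
have /choice[J JP] i : exists j,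
    (j <= i)%N /\ forall j', (j' <= i)%N -> r i j' <= r i j.
  case: (@arg_maxP _ _ _ (@ord0 i) predT (fun j : 'I_i.+1 => r i j) isT).
  move=> j _ jmax; exists j; split=> [|j' j'i]; first by rewrite -ltnS.
  exact: (jmax (Ordinal (j'i : (j' < i.+1)%N))).
pose M i := r i (J i).
have M0 i : 0 <= M i.
  have [Ji _] := JP i; apply: divr_ge0; last exact/ltW/mus.
  by apply: sumr_ge0 => k _; rewrite mulr_ge0 // ltW.
have Mub i j : (j <= i)%N ->
    \sum_(j <= k < i.+1) f k * mu k <= M i * \sum_(j <= k < i.+1) mu k.
  by move=> ji; have [_ Jmax] := JP i; rewrite -ler_pdivrMr ?mus //; exact: Jmax.
exists M; split=> //; rewrite !big_mkord.
apply: (maximal_lp R _ p (fun i : 'I_n => mu i) (fun i : 'I_n => f i)) => // t.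
rewrite -(big_mkord (fun i => t <= M i) (fun i => (f i - t) * mu i)).
apply: backward_weak_type => // i; have [Ji _] := JP i; exists (J i) => //.
by rewrite /M /r divfK // gt_eqF // mus.
Qed.

Lemma sum_nat_rev (V : nmodType) (F : nat -> V) n j i : (j <= i <= n)%N ->
  \sum_(j <= k < i) F k = \sum_(n - i <= k < n - j) F (n - k.+1)%N.
Proof.
move=> /andP[ji]; elim: i ji => [|i IHi].
  by rewrite leqn0 => /eqP-> _; rewrite subn0 !big_geq.
rewrite leq_eqVlt => /orP[/eqP-> _|]; first by rewrite !big_geq.
rewrite ltnS => ji i_n; rewrite big_nat_recr //= IHi //; last exact: ltnW.
rewrite [RHS]big_ltn; last by lia.
have -> : (n - i.+1).+1 = (n - i)%N by lia.
by rewrite addrC; congr (F _ + _); lia.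
Qed.

(** Reflecting the window by [k -> n - 1 - k] turns blocks starting at [i] into blocks ending at the
    mirror point; hence the restriction [b <= n]. *)
Lemma forward_maximal (R : realType) (p : R) (mu f : nat -> R) (n : nat) :
  1 < p -> (forall k, 0 < mu k) -> (forall k, 0 <= f k) ->
  exists M : nat -> R, [/\ forall i, 0 <= M i,
    forall i b, (i < b <= n)%N ->
      \sum_(i <= k < b) f k * mu k <= M i * \sum_(i <= k < b) mu k &
    \sum_(0 <= i < n) M i `^ p * mu i <=
      conj_exp p `^ p * \sum_(0 <= i < n) f i `^ p * mu i].
Proof.
move=> p1 mu0 f0.
have [M [M0 Mub Mlp]] := backward_maximal R p (fun k => mu (n - k.+1)%N)
  (fun k => f (n - k.+1)%N) n p1 (fun=> mu0 _) (fun=> f0 _).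
exists (fun i => M (n - i.+1)%N); split=> // [i b /andP[ib bn]|].
  have ibn : (i <= b <= n)%N by rewrite bn ltnW.
  rewrite (sum_nat_rev _ (fun k => f k * mu k) n i b ibn).
  rewrite (sum_nat_rev _ mu n i b ibn).
  have -> : (n - i = (n - i.+1).+1)%N by lia.
  by apply: Mub; lia.
move: Mlp; rewrite (sum_nat_rev _ (fun i => M i `^ p * mu (n - i.+1)%N) n 0 n) ?leqnn //.
rewrite subnn subn0.
rewrite (sum_nat_rev _ (fun i => f i `^ p * mu i) n 0 n) ?leqnn // subnn subn0.
apply: le_trans; rewrite le_eqVlt; apply/orP; left; apply/eqP.
by apply: eq_big_nat => i /andP[_ i_n]; congr (_ * mu _); lia.
Qed.

(** The factor [2 ^ p] comes from [(M1 + M2) ^ p <= 2 ^ p * (M1 ^ p + M2 ^ p)], the other 2 from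
    adding the two one-sided bounds. *)
Definition maximal_const (R : realType) (p : R) : R :=
  2 `^ p * (2 * conj_exp p `^ p).

Lemma weighted_maximal (R : realType) (p : R) (mu f : nat -> R) (n : nat) :
  1 < p -> (forall k, 0 < mu k) -> (forall k, 0 <= f k) ->
  exists M : nat -> R, [/\ forall i, 0 <= M i,
    forall i a b, (a <= i < b)%N -> (b <= n)%N ->
      \sum_(a <= k < b) f k * mu k <= M i * \sum_(a <= k < b) mu k &
    \sum_(0 <= i < n) M i `^ p * mu i <=
      maximal_const R p * \sum_(0 <= i < n) f i `^ p * mu i].
Proof.
move=> p1 mu0 f0.
have [M1 [M10 M1ub M1lp]] := backward_maximal R p mu f n p1 mu0 f0.
have [M2 [M20 M2ub M2lp]] := forward_maximal R p mu f n p1 mu0 f0.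
exists (fun i => M1 i + M2 i); split=> [i|i a b /andP[ai ib] bn|].
- exact: addr_ge0.
- have mu_ge (c d : nat) : 0 <= \sum_(c <= k < d) mu k.
    by apply: sumr_ge0 => k _; exact: ltW.
  have H1 := M1ub i a ai.
  have H2 : \sum_(i <= k < b) f k * mu k <= M2 i * \sum_(i <= k < b) mu k.
    by apply: M2ub; rewrite ib.
  have E1 : \sum_(a <= k < b) f k * mu k <=
      \sum_(a <= k < i.+1) f k * mu k + \sum_(i <= k < b) f k * mu k.
    (* The block is cut at [i] with [i] kept in both pieces; the doubly counted term is
       nonnegative. *)
    rewrite (big_cat_nat _ (n := i.+1)) //=; last exact: leqW.
    by rewrite lerD2l [leRHS]big_ltn // lerDr mulr_ge0 // ltW.
  have E2 : \sum_(a <= k < i.+1) mu k <= \sum_(a <= k < b) mu k.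
    by rewrite [leRHS](big_cat_nat _ (n := i.+1)) ?lerDl //=; exact: leqW.
  have E3 : \sum_(i <= k < b) mu k <= \sum_(a <= k < b) mu k.
    by rewrite [leRHS](big_cat_nat _ (n := i)) ?lerDr //=; exact: ltnW.
  have h1 := ler_wpM2l (M10 i) E2; have h2 := ler_wpM2l (M20 i) E3.
  rewrite mulrDl; lra.
rewrite /maximal_const; set S := \sum_(0 <= i < n) f i `^ p * mu i in M1lp M2lp *.
have p0 : 0 < p by lra.
have : \sum_(0 <= i < n) (M1 i + M2 i) `^ p * mu i <= 2 `^ p *
    (\sum_(0 <= i < n) M1 i `^ p * mu i + \sum_(0 <= i < n) M2 i `^ p * mu i).
  rewrite -big_split /= mulr_sumr; apply: ler_sum => i _.
  rewrite -mulrDl mulrA ler_pM2r //.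
  wlog le12 : M1 M2 M10 M20 {M1ub M2ub M1lp M2lp} / M1 i <= M2 i.
    move=> W; have [|/ltW] := leP (M1 i) (M2 i); first exact: W.
    by move=> /(W M2 M1 M20 M10); rewrite addrC [in leRHS]addrC.
  have : (M1 i + M2 i) `^ p <= (2 * M2 i) `^ p.
    by rewrite ge0_ler_powR ?nnegrE ?addr_ge0 ?mulr_ge0 ?(ltW p0) //; lra.
  move=> /le_trans; apply; rewrite powRM // ler_wpM2l ?powR_ge0 //.
  by rewrite lerDr powR_ge0.
have := powR_ge0 2 p; set t := 2 `^ p => t0 /le_trans; apply.
by rewrite -mulrA ler_wpM2l //; lra.
Qed.

(** * The fractional estimate on a finite window *)

(* The exponent of [U / n] left over after extracting the A(p,q) bracket is
   [a / p - c / q = alpha], where [a = 1 + c / q]. *)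
Lemma fractional_average_le (R : realType) (alpha p q K n S U X hm H G : R) :
  0 < alpha -> 1 < p -> 0 < q -> q^-1 = p^-1 - alpha ->
  0 < n -> 0 < S -> 0 < U -> 0 <= X -> 0 <= hm -> hm <= H ->
  let c := conj_exp p in let a := 1 + c / q in
  n * (X / S) `^ (p / a) <= U * hm -> U * hm `^ a <= G ->
  (U / n) `^ q^-1 * (S / n) `^ c^-1 <= K ->
  (n `^ (1 - alpha))^-1 * X <= K `^ c * G `^ alpha * H `^ (a / q).
Proof.
move=> al0 p1 q0 hq n0 S0 U0 X0 hm0 hmH c a.
have [c1 pc pc1] := conj_exp_props R p p1; rewrite -/c in c1 pc pc1 *.
have a0 : 0 < a by rewrite /a ltr_wpDr // divr_ge0 // ltW //; lra.
have p0 : 0 < p by lra.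
have c0 : 0 < c by lra.
have S0n : 0 < S / n by rewrite divr_gt0.
have U0n : 0 < U / n by rewrite divr_gt0.
move=> h1 h2 h3.
have gle : X / S <= (U * hm / n) `^ (a / p).
  rewrite -[leLHS](powRr1 (divr_ge0 X0 (ltW S0))) (_ : 1 = (p / a) * (a / p)).
    rewrite powRrM; apply: ge0_ler_powR; rewrite ?nnegrE ?powR_ge0 //.
    - by rewrite divr_ge0 // ltW.
    - by rewrite divr_ge0 ?mulr_ge0 // ltW.
    - by rewrite ler_pdivlMr // mulrC.
  by field; rewrite !gt_eqF.
(* This is the A(p,q) bound raised to the power [c], which gives [S / n] exponent 1. *)
have K4 : (U / n) `^ (c / q) * (S / n) <= K `^ c.
  have -> : (U / n) `^ (c / q) * (S / n) =
      ((U / n) `^ q^-1 * (S / n) `^ c^-1) `^ c.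
    rewrite [RHS]powRM ?powR_ge0 // -!powRrM mulVf ?gt_eqF // powRr1 ?(ltW S0n) //.
    by rewrite [c / q]mulrC.
  have l0 : 0 <= (U / n) `^ q^-1 * (S / n) `^ c^-1 by rewrite mulr_ge0 ?powR_ge0.
  by rewrite ge0_ler_powR ?nnegrE ?(ltW c0) // (le_trans l0).
have aE : a / p = c / q + alpha.
  have -> : alpha = p^-1 - q^-1 by lra.
  have -> : a / p = p^-1 + c / q * p^-1 by rewrite /a mulrDl mul1r.
  have -> : p^-1 = 1 - c^-1 by lra.
  by field; rewrite !gt_eqF.
(* This splits the power of [hm]: the part [a * alpha] joins [U ^ alpha] and is bounded by the
   global quantity [G], while the part [a / q] stays local and is bounded through [H]. *)
have aE2 : a / p = a * alpha + a / q.
  by rewrite (_ : p^-1 = alpha + q^-1); [ring | lra].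
have nE : (n `^ (1 - alpha))^-1 = n^-1 * n `^ alpha.
  rewrite -powRN opprB addrC powRD; last by rewrite (gt_eqF n0) implybT.
  by rewrite powR_inv1 // ltW.
have step : (n `^ (1 - alpha))^-1 * X <= ((U / n) `^ (c / q) * (S / n)) *
    ((U * hm `^ a) `^ alpha * hm `^ (a / q)).
  apply: le_trans (_ : n^-1 * n `^ alpha * (S * (U * hm / n) `^ (a / p)) <= _).
    rewrite nE ler_wpM2l ?mulr_ge0 ?invr_ge0 ?powR_ge0 ?(ltW n0) //.
    by rewrite -ler_pdivrMl // mulrC.
  rewrite le_eqVlt; apply/orP; left; apply/eqP.
  rewrite (_ : U * hm / n = (U / n) * hm); last by ring.
  rewrite (powRM _ (ltW U0n) hm0) [in X in X * hm `^ _]aE.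
  rewrite powRD; last by rewrite (gt_eqF U0n) implybT.
  rewrite [hm `^ (a / p)](_ : _ = hm `^ (a * alpha) * hm `^ (a / q)); last first.
    rewrite aE2 powRD //; apply/implyP => /eqP; rewrite -aE2 => h.
    by have := divr_gt0 a0 p0; rewrite h ltxx.
  rewrite [(U * hm `^ a) `^ alpha]powRM ?powR_ge0 ?(ltW U0) // -powRrM.
  rewrite [U `^ alpha](_ : _ = (U / n) `^ alpha * n `^ alpha); last first.
    by rewrite -powRM ?(ltW U0n) ?(ltW n0) // divfK ?gt_eqF.
  by ring.
apply: le_trans step _; rewrite -(mulrA (K `^ c)).
have Um0 : 0 <= U * hm `^ a by rewrite mulr_ge0 ?powR_ge0 ?(ltW U0).
apply: ler_pM => //; first by rewrite mulr_ge0 ?powR_ge0 ?(ltW S0n).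
  by rewrite mulr_ge0 ?powR_ge0.
apply: ler_pM; rewrite ?powR_ge0 // ge0_ler_powR ?nnegrE //.
- exact: ltW.
- exact: le_trans h2.
- by rewrite divr_ge0 // ltW.
- exact: le_trans hmH.
Qed.

(** A bound for the sum of [q]-th powers: [K ^ c] is raised to the power [q], and the product of the
    two maximal constants to [alpha * q + 1 = q / p]. *)
Definition fractional_const (R : realType) (p q K : R) : R :=
  K `^ (conj_exp p * q) *
  (maximal_const R (1 + conj_exp p / q) * maximal_const R p) `^ (q / p).

Lemma maximal_const_gt0 (R : realType) (p : R) : 1 < p -> 0 < maximal_const R p.
Proof.
move=> p1; have [c1 _ _] := conj_exp_props R p p1.
by rewrite /maximal_const !mulr_gt0 ?powR_gt0 //; lra.
Qed.

Lemma sum_subrange_le (R : realType) (F : nat -> R) (a b n : nat) :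
  (a <= b <= n)%N -> (forall k, 0 <= F k) ->
  \sum_(a <= k < b) F k <= \sum_(0 <= k < n) F k.
Proof.
move=> /andP[ab bn] F0.
rewrite [leRHS](big_cat_nat _ (n := a)) //=; last exact: leq_trans bn.
rewrite (big_cat_nat _ (n := b) (m := a) (p := n)) //=.
have h c d : 0 <= \sum_(c <= k < d) F k by apply: sumr_ge0.
by have := h 0 a; have := h b n; lra.
Qed.

Lemma sumr_const_range (R : realType) (r : R) a b :
  \sum_(a <= k < b) r = (b - a)%:R * r.
Proof. by rewrite big_const_nat iter_addr_0 mulr_natl. Qed.

Lemma fractional_maximal_window (R : realType) (alpha p q K : R)
    (w x : nat -> R) (n : nat) :
  0 < alpha -> 1 < p -> 0 < q -> q^-1 = p^-1 - alpha -> 0 <= K ->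
  (forall k, 0 < w k) -> (forall k, 0 <= x k) ->
  (forall a b, (a < b <= n)%N ->
    ((\sum_(a <= k < b) w k `^ q) / (b - a)%:R) `^ q^-1 *
    ((\sum_(a <= k < b) w k `^ (- conj_exp p)) / (b - a)%:R) `^ (conj_exp p)^-1
      <= K) ->
  exists B : nat -> R, [/\ forall i, 0 <= B i,
    forall i a b, (a <= i < b)%N -> (b <= n)%N ->
      ((b - a)%:R `^ (1 - alpha))^-1 * \sum_(a <= k < b) x k <= B i &
    \sum_(0 <= i < n) B i `^ q * w i `^ q <= fractional_const R p q K *
      (\sum_(0 <= i < n) x i `^ p * w i `^ p) `^ (q / p)].
Proof.
move=> al0 p1 q0 hq K0 w0 x0 hK.
have [c1 pc pc1] := conj_exp_props R p p1.
rewrite /fractional_const; set c := conj_exp p in c1 pc pc1 hK *.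
pose a := 1 + c / q; rewrite -/a.
have c0 : 0 < c by lra.
have p0 : 0 < p by lra.
have a1 : 1 < a by rewrite /a ltrDl divr_gt0.
have a0 : 0 < a by lra.
pose s k := w k `^ (- c); pose u k := w k `^ q.
have s0 k : 0 < s k by exact: powR_gt0.
have u0 k : 0 < u k by exact: powR_gt0.
pose f k := x k / s k.
have f0 k : 0 <= f k by rewrite divr_ge0 // ltW.
have [g [g0 gub glp]] := weighted_maximal R p s f n p1 s0 f0.
pose h k := g k `^ (p / a) / u k.
have h0 k : 0 <= h k by rewrite divr_ge0 ?powR_ge0 // ltW.
have [H [H0 Hub Hlp]] := weighted_maximal R a u h n a1 u0 h0.
set G := \sum_(0 <= i < n) H i `^ a * u i in Hlp.
have G0 : 0 <= G by apply: sumr_ge0 => k _; rewrite mulr_ge0 ?powR_ge0 ?(ltW (u0 _)).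
(* The right-hand side of [fractional_average_le], with [G] the sum of [H ^ a * u] over the whole
   window. *)
exists (fun i => K `^ c * G `^ alpha * H i `^ (a / q)); split=> [i|i l r lir rn|].
- by rewrite !mulr_ge0 ?powR_ge0.
- have lr : (l < r)%N by case/andP: lir; apply: leq_ltn_trans.
  have N0 : 0 < (r - l)%:R :> R by rewrite ltr0n subn_gt0.
  have sfx : \sum_(l <= k < r) f k * s k = \sum_(l <= k < r) x k.
    by apply: eq_bigr => k _; rewrite divfK // gt_eqF.
  have huE : \sum_(l <= k < r) h k * u k = \sum_(l <= k < r) g k `^ (p / a).
    by apply: eq_bigr => k _; rewrite divfK // gt_eqF.
  have S0 := sum_nat_gt0 R s l r s0 lr; have U0 := sum_nat_gt0 R u l r u0 lr.
  have X0 : 0 <= \sum_(l <= k < r) x k by apply: sumr_ge0.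
  have Y0 : 0 <= \sum_(l <= k < r) h k * u k.
    by apply: sumr_ge0 => k _; rewrite mulr_ge0 // ltW.
  pose hm := (\sum_(l <= k < r) h k * u k) / \sum_(l <= k < r) u k.
  have hm0 : 0 <= hm by rewrite divr_ge0 // ltW.
  have hmH k : (l <= k < r)%N -> hm <= H k.
    by move=> lkr; rewrite ler_pdivrMr // Hub.
  have gmg k : (l <= k < r)%N ->
      (\sum_(l <= k < r) x k) / \sum_(l <= k < r) s k <= g k.
    by move=> lkr; rewrite ler_pdivrMr // -sfx gub.
  apply: (@fractional_average_le R alpha p q K _ _ _ _ hm _ _ al0 p1 q0 hq N0 S0 U0) => //.
  + exact: hmH.
  + rewrite -/c -/a [leRHS]mulrC divfK ?gt_eqF // huE -sumr_const_range.
    rewrite big_nat_cond [leRHS]big_nat_cond.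
    apply: ler_sum => k /andP[lkr _].
    rewrite ge0_ler_powR ?nnegrE ?divr_ge0 ?(ltW S0) ?(ltW a0) ?(ltW p0) //.
    exact: gmg.
  + rewrite -/c -/a; apply: le_trans (_ : \sum_(l <= k < r) H k `^ a * u k <= _).
      rewrite mulr_suml big_nat_cond [leRHS]big_nat_cond.
      apply: ler_sum => k /andP[lkr _]; rewrite mulrC ler_pM2r //.
      by rewrite ge0_ler_powR ?nnegrE ?(ltW a0) // hmH.
    apply: sum_subrange_le; first by rewrite (ltnW lr).
    by move=> k; rewrite mulr_ge0 ?powR_ge0 ?(ltW (u0 _)).
  + by apply: hK; rewrite lr.
(* Summing [B ^ q * u] produces [G ^ (alpha * q)] times one further [G], that is [G ^ (q / p)]. *)
have qp : q / p = alpha * q + 1.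
  by rewrite (_ : p^-1 = alpha + q^-1); [field; rewrite gt_eqF | lra].
have -> : \sum_(0 <= i < n)
    (K `^ c * G `^ alpha * H i `^ (a / q)) `^ q * w i `^ q =
    K `^ (c * q) * G `^ (q / p).
  have qp0 : alpha * q + 1 != 0 by rewrite -qp gt_eqF // divr_gt0.
  rewrite qp powRD ?(negPf qp0) // powRr1 // mulrA mulr_sumr.
  apply: eq_bigr => i _; rewrite powRM ?mulr_ge0 ?powR_ge0 //.
  rewrite powRM ?powR_ge0 // -!powRrM.
  by rewrite divfK ?gt_eqF // !mulrA.
rewrite -mulrA ler_wpM2l ?powR_ge0 //.
have Ca := maximal_const_gt0 R a a1; have Cp := maximal_const_gt0 R p p1.
have F0 : 0 <= \sum_(0 <= i < n) x i `^ p * w i `^ p.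
  by apply: sumr_ge0 => k _; rewrite mulr_ge0 ?powR_ge0.
rewrite -powRM ?(ltW (mulr_gt0 _ _)) //.
apply: ge0_ler_powR; rewrite ?nnegrE //.
- by rewrite divr_ge0 // ltW.
- by rewrite (mulr_ge0 (ltW (mulr_gt0 Ca Cp))).
apply: le_trans Hlp _; rewrite -mulrA ler_pM2l //.
(* Here [h ^ a * u = g ^ p * u ^ (1 - a)], and [u ^ (1 - a) = w ^ (- c) = s]. *)
have -> : \sum_(0 <= i < n) h i `^ a * u i = \sum_(0 <= i < n) g i `^ p * s i.
  apply: eq_bigr => i _; rewrite /h powRM ?powR_ge0 ?invr_ge0 ?(ltW (u0 _)) //.
  rewrite -powRrM divfK ?gt_eqF // -mulrA; congr (_ * _).
  rewrite -powR_inv1 ?(ltW (u0 _)) // -powRrM /u -powRrM -powRD.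
    by rewrite /s /a; congr (_ `^ _); field; rewrite gt_eqF.
  by rewrite (gt_eqF (w0 i)) implybT.
(* Here [f ^ p * s = x ^ p * s ^ (1 - p)], and [s ^ (1 - p) = w ^ p] because [(p - 1) * c = p]. *)
have -> : \sum_(0 <= i < n) x i `^ p * w i `^ p = \sum_(0 <= i < n) f i `^ p * s i.
  apply: eq_bigr => i _; rewrite /f powRM ?invr_ge0 ?(ltW (s0 _)) //.
  rewrite -mulrA; congr (_ * _).
  rewrite -powR_inv1 ?(ltW (s0 _)) // -powRrM /s -powRrM -powRD.
    by congr (_ `^ _); rewrite -[LHS]pc1; ring.
  by rewrite (gt_eqF (w0 i)) implybT.
exact: glp.
Qed.

(** * Transfer between integer intervals and ranges of natural numbers *)

(** An integer origin with natural offsets lets sums over integer intervals become [nat]-indexed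
    sums; the right end is excluded, as in big operators. *)
Definition int_range (o : int) (l r : nat) : set int :=
  [set k | o + l%:Z <= k < o + r%:Z].

Lemma int_rangeE o l r : (l <= r)%N ->
  int_range o l r = (fun i : nat => o + (i + l)%:Z) @` `I_(r - l).
Proof.
move=> lr; apply/seteqP; split=> k /=; last first.
  by move=> [i il <-]; apply/andP; split; lia.
by move=> /andP[h1 h2]; exists (absz (k - (o + l%:Z))%R); lia.
Qed.

Lemma finite_int_range o l r : finite_set (int_range o l r).
Proof.
have [lr|/ltnW lr] := leqP l r; first by rewrite int_rangeE //; exact: finite_image.
apply: (sub_finite_set (B := set0)) => // k /= /andP[h1 h2]; exfalso; lia.
Qed.

Lemma card_int_range o l r : (l <= r)%N -> card_set (int_range o l r) = (r - l)%N.
Proof.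
move=> lr; apply: card_fset_set; rewrite int_rangeE //; apply: inj_card_eq.
by move=> i j _ _ /= h; lia.
Qed.

Lemma fsbig_int_range (R : realType) (F : int -> R) o l r : (l <= r)%N ->
  \sum_(k \in int_range o l r) F k = \sum_(l <= i < r) F (o + i%:Z).
Proof.
move=> lr; rewrite int_rangeE // fsbig_image; last by move=> i j _ _ /= h; lia.
rewrite -(fsbig_ord _ _ (fun i => F (o + (i + l)%:Z))).
by rewrite -[in RHS](add0n l) big_addn big_mkord.
Qed.

Lemma int_interval_range o l r : (l < r)%N -> int_interval (int_range o l r).
Proof.
move=> lr; exists (o + l%:Z), (o + r%:Z - 1); split; first by lia.
by apply/seteqP; split=> k /= /andP[h1 h2]; apply/andP; split; lia.
Qed.

Lemma ball_int_range m N o l : m - N%:Z = o + l%:Z ->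
  ball_int m N = int_range o l (l + N.*2.+1).
Proof.
move=> h; apply/seteqP; split=> k; rewrite /ball_int /int_range /= ler_distl.
  by move=> /andP[h1 h2]; apply/andP; split; lia.
by move=> /andP[h1 h2]; apply/andP; split; lia.
Qed.

Lemma A_class_bound (R : realType) (p q : R) (w : int -> R) : A_class p q w ->
  exists2 K : R, 0 <= K & forall o l r, (l < r)%N ->
    ((\sum_(l <= i < r) w (o + i%:Z) `^ q) / (r - l)%:R) `^ q^-1 *
    ((\sum_(l <= i < r) w (o + i%:Z) `^ (- conj_exp p)) / (r - l)%:R)
      `^ (conj_exp p)^-1 <= K.
Proof.
rewrite /A_class /=; set E := [set _ | _ in _] => Elt.
have Eub o l r : (l < r)%N ->
   ((((\sum_(l <= i < r) w (o + i%:Z) `^ q) / (r - l)%:R) `^ q^-1 *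
    ((\sum_(l <= i < r) w (o + i%:Z) `^ (- conj_exp p)) / (r - l)%:R)
      `^ (conj_exp p)^-1)%:E <= ereal_sup E)%E.
  move=> lr; apply: ereal_sup_ubound; exists (int_range o l r).
    exact: int_interval_range.
  rewrite /average card_int_range; last exact: ltnW.
  rewrite !fsbig_int_range; try exact: ltnW.
  by rewrite ![_^-1 * \sum_(_ <= _ < _) _]mulrC.
(* The one-point interval at the origin shows that a finite supremum is nonnegative and that it is
   not [-oo]. *)
case: (ereal_sup E) Elt Eub => [K|//|] _ Eub.
  exists K => [|o l r /(Eub o)]; last by rewrite lee_fin.
  have := Eub 0 0%N 1%N isT; rewrite lee_fin; apply: le_trans.
  by rewrite mulr_ge0 ?powR_ge0.
by have := Eub 0 0%N 1%N isT; rewrite leeNy_eq.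
Qed.

(** * Bounds for ball averages, uniform over windows and finite sets of centres *)

Definition ball_average (R : realType) (alpha : R) (x : int -> R) (m : int)
    (N : nat) : R :=
  ((card_set (ball_int m N))%:R `^ (1 - alpha))^-1 *
  \sum_(k \in ball_int m N) `|x k|.

Lemma ball_average_ge0 (R : realType) (alpha : R) (x : int -> R) m N :
  0 <= ball_average R alpha x m N.
Proof. by rewrite mulr_ge0 ?invr_ge0 ?powR_ge0 // fsumr_ge0. Qed.

(** The window is [[-L, L]], with [2 L + 1] points; the condition on [m] and [N] says that the ball
    fits inside. [B] may depend on [L], but the final bound does not. *)
Lemma fractional_maximal_int (R : realType) (alpha p q K : R) (w x : int -> R)
    (F : R) (L : nat) :
  0 < alpha -> 1 < p -> 0 < q -> q^-1 = p^-1 - alpha -> 0 <= K ->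
  (forall k, 0 < w k) ->
  (forall o l r, (l < r)%N ->
    ((\sum_(l <= i < r) w (o + i%:Z) `^ q) / (r - l)%:R) `^ q^-1 *
    ((\sum_(l <= i < r) w (o + i%:Z) `^ (- conj_exp p)) / (r - l)%:R)
      `^ (conj_exp p)^-1 <= K) ->
  (forall A : set int, finite_set A -> \sum_(k \in A) `|x k| `^ p * w k `^ p <= F) ->
  exists B : int -> R, [/\ forall m, 0 <= B m,
    forall m N, (`|m| + N <= L)%N -> ball_average R alpha x m N <= B m &
    \sum_(m \in int_range (- L%:Z) 0 L.*2.+1) B m `^ q * w m `^ q <=
      fractional_const R p q K * F `^ (q / p)].
Proof.
move=> al0 p1 q0 hq K0 w0 hK hF.
have p0 : 0 < p by lra.
have [B [B0 Bub Blp]] := fractional_maximal_window R alpha p q K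
  (fun i => w (- L%:Z + i%:Z)) (fun i => `|x (- L%:Z + i%:Z)|) L.*2.+1
  al0 p1 q0 hq K0 (fun=> w0 _) (fun=> normr_ge0 _)
  (fun l r h => hK (- L%:Z) l r (proj1 (andP h))).
exists (fun m => B (absz (m + L%:Z)%R)); split=> // [m N mNL|].
  pose l := absz (m - N%:Z + L%:Z)%R.
  rewrite /ball_average (ball_int_range m N (- L%:Z) l); last by rewrite /l; lia.
  rewrite card_int_range ?leq_addr // fsbig_int_range ?leq_addr //.
  by apply: Bub; rewrite /l; lia.
rewrite fsbig_int_range //.
have -> : \sum_(0 <= i < L.*2.+1)
      B (absz (- L%:Z + i%:Z + L%:Z)%R) `^ q * w (- L%:Z + i%:Z) `^ q =
    \sum_(0 <= i < L.*2.+1) B i `^ q * w (- L%:Z + i%:Z) `^ q.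
  by apply: eq_bigr => i _; congr (B _ `^ _ * _); lia.
apply: le_trans Blp _; rewrite ler_wpM2l //.
  by rewrite /fractional_const mulr_ge0 ?powR_ge0.
have := hF _ (finite_int_range (- L%:Z) 0 L.*2.+1); rewrite fsbig_int_range //.
have S0 : 0 <= \sum_(0 <= i < L.*2.+1)
    `|x (- L%:Z + i%:Z)| `^ p * w (- L%:Z + i%:Z) `^ p.
  by apply: sumr_ge0 => i _; rewrite mulr_ge0 ?powR_ge0.
move=> SF; apply: ge0_ler_powR; rewrite ?nnegrE //; last exact: le_trans SF.
by rewrite divr_ge0 // ltW.
Qed.

Lemma finite_int_bound (A : set int) (N : int -> nat) : finite_set A ->
  exists L : nat, forall m, A m -> (`|m| + N m <= L)%N.
Proof.
move=> Afin; exists (\max_(m <- fset_set A) (`|m| + N m)%N) => m Am.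
apply: (@leq_bigmax_seq _ _ predT (fun m => (`|m| + N m)%N)) => //.
by rewrite in_fset_set // inE.
Qed.

(** A linearized form of the maximal estimate: each centre has its own radius, and one window large
    enough for all these balls is used. Uniformity in [A] and [N] permits the later passage to
    suprema. *)
Lemma sum_ball_averages_le (R : realType) (alpha p q K : R) (w x : int -> R)
    (F : R) (A : set int) (N : int -> nat) :
  0 < alpha -> 1 < p -> 0 < q -> q^-1 = p^-1 - alpha -> 0 <= K ->
  (forall k, 0 < w k) ->
  (forall o l r, (l < r)%N ->
    ((\sum_(l <= i < r) w (o + i%:Z) `^ q) / (r - l)%:R) `^ q^-1 *
    ((\sum_(l <= i < r) w (o + i%:Z) `^ (- conj_exp p)) / (r - l)%:R)
      `^ (conj_exp p)^-1 <= K) ->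
  (forall A : set int, finite_set A -> \sum_(k \in A) `|x k| `^ p * w k `^ p <= F) ->
  finite_set A ->
  \sum_(m \in A) ball_average R alpha x m (N m) `^ q * w m `^ q <=
    fractional_const R p q K * F `^ (q / p).
Proof.
move=> al0 p1 q0 hq K0 w0 hK hF Afin.
have [L AL] := finite_int_bound A N Afin.
have [B [B0 Bub Bsum]] := fractional_maximal_int R alpha p q K w x F L
  al0 p1 q0 hq K0 w0 hK hF.
apply: le_trans Bsum.
pose W := int_range (- L%:Z) 0 L.*2.+1.
have AW : A `<=` W.
  by move=> m /AL h; apply/andP; split; lia.
apply: (@le_trans _ _ (\sum_(m \in A) B m `^ q * w m `^ q)).
  rewrite !fsbig_finite //= big_seq_cond [leRHS]big_seq_cond.
  apply: ler_sum => m; rewrite andbT in_fset_set // inE => Am.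
  rewrite ler_pM2r ?powR_gt0 //; apply: ge0_ler_powR; rewrite ?nnegrE //.
  - exact: ltW.
  - exact: ball_average_ge0.
  - by apply: Bub; exact: AL.
rewrite -lee_fin -!fsumEFin //; last exact: finite_int_range.
apply: lee_fsum_nneg_subset => //; first exact: finite_int_range.
  by move=> m; rewrite !inE; exact: AW.
by move=> m _; rewrite lee_fin mulr_ge0 ?powR_ge0.
Qed.

Theorem theorem3p7 (R : realType) (alpha p q : R) (w : int -> R)
  (halpha : 0 < alpha < 1) (hp : 1 < p < alpha^-1)
  (hq : q^-1 = p^-1 - alpha)
  (hw : weight w) (hA : A_class p q w) :
  exists C : R, 0 < C /\
    forall x : int -> R, lp p (weight_pow w p) x ->
      [/\ (forall m : int, frac_max alpha x m \is a fin_num),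
          lp q (weight_pow w q) (fun m => fine (frac_max alpha x m))
        & (lp_norm q (weight_pow w q) (fun m => fine (frac_max alpha x m))
           <= C%:E * lp_norm p (weight_pow w p) x)%E].
Proof.
case/andP: halpha => al0 _; case/andP: hp => p1 pal.
have p0 : 0 < p by lra.
have q0 : 0 < q.
  by rewrite -invr_gt0 hq subr_gt0 -(invrK alpha) ltf_pV2 // posrE ?invr_gt0.
have qV : q * q^-1 = 1 by rewrite mulfV ?gt_eqF.
have [K K0 hK] := A_class_bound R p q w hA.
set C0 := fractional_const R p q K.
have C00 : 0 <= C0 by rewrite /C0 /fractional_const mulr_ge0 ?powR_ge0.
(* The 2 pays for radii that reach only half of the supremum; the 1 makes [C] strictly positive,
   since only [0 <= C0] is at hand. *)
pose C := 2 * C0 `^ q^-1 + 1.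
have C2 : 2 * C0 `^ q^-1 <= C by rewrite /C lerDl.
have Cp : 0 < C by rewrite /C ltr_wpDl // mulr_ge0 // powR_ge0.
exists C; split=> // x xlp.
pose e := (\esum_(k in [set: int]) (`|x k| `^ p * weight_pow w p k)%:E)%E.
have e0 : (0 <= e)%E.
  by apply: esum_ge0 => k _; rewrite lee_fin mulr_ge0 ?powR_ge0.
have elt : (e < +oo)%E.
  by apply: lty_poweRy xlp; rewrite invr_neq0 // gt_eqF.
pose F := fine e.
have eF : e = F%:E by rewrite /F fineK // ge0_fin_numE.
have F0 : 0 <= F by rewrite -lee_fin -eF.
have hF (A : set int) : finite_set A -> \sum_(k \in A) `|x k| `^ p * w k `^ p <= F.
  move=> Afin; rewrite -lee_fin -eF -fsumEFin //.
  by apply: ereal_sup_ubound; exists A.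
pose D := C0 * F `^ (q / p).
have D0 : 0 <= D by rewrite mulr_ge0 ?powR_ge0.
have avgD (A : set int) (N : int -> nat) : finite_set A ->
    \sum_(m \in A) ball_average R alpha x m (N m) `^ q * w m `^ q <= D.
  exact: (sum_ball_averages_le R alpha p q K w x F A N).
have fmE m : frac_max alpha x m =
  ereal_sup (range (fun N => (ball_average R alpha x m N)%:E)) by [].
have fm_ge m N : ((ball_average R alpha x m N)%:E <= frac_max alpha x m)%E.
  by rewrite fmE; apply: ereal_sup_ubound; exists N.
have fm_fin m : frac_max alpha x m \is a fin_num.
  rewrite ge0_fin_numE; last first.
    by apply: le_trans (fm_ge m 0%N); rewrite lee_fin ball_average_ge0.
  (* A single centre with arbitrary radius already bounds every ball average at [m], so the supremum
     is finite. *)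
  apply: le_lt_trans (ltry ((D / w m `^ q) `^ q^-1)).
  rewrite fmE; apply: ge_ereal_sup => _ [N _ <-]; rewrite lee_fin.
  have := avgD [set m] (fun=> N) (finite_set1 m); rewrite fsbig_set1.
  rewrite -ler_pdivlMr ?powR_gt0 // => h.
  have b0 := ball_average_ge0 R alpha x m N.
  rewrite -[leLHS](powRr1 b0) -qV powRrM.
  apply: ge0_ler_powR; rewrite ?nnegrE ?powR_ge0 //.
    by rewrite invr_ge0 ltW.
  by rewrite divr_ge0 ?powR_ge0.
pose G m := fine (frac_max alpha x m).
have GE m : frac_max alpha x m = (G m)%:E by rewrite /G fineK.
have G0 m : 0 <= G m.
  by rewrite -lee_fin -GE (le_trans _ (fm_ge m 0%N)) // lee_fin ball_average_ge0.
(* The supremum need not be attained, so a radius reaching half of it is chosen; if it is 0, any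
   radius serves. *)
have /choice[N NP] m : exists N, G m <= 2 * ball_average R alpha x m N.
  have [G00|/eqP Gn0] := eqVneq (G m) 0.
    by exists 0%N; rewrite G00 mulr_ge0 // ball_average_ge0.
  have Gp : 0 < G m by rewrite lt_neqAle G0 andbT eq_sym; apply/eqP.
  have : ((G m / 2)%:E < frac_max alpha x m)%E by rewrite GE lte_fin; lra.
  rewrite fmE => /ereal_sup_gt[_ [N _ <-]]; rewrite lte_fin => h.
  by exists N; lra.
(* An [esum] of nonnegative terms is the supremum of its finite partial sums, to which [avgD]
   applies with the chosen radii. *)
have Gsum : (\esum_(k in [set: int]) (`|G k| `^ q * weight_pow w q k)%:E
    <= (2 `^ q * D)%:E)%E.
  apply: ge_ereal_sup => _ [A [Afin _] <-].
  rewrite fsumEFin // lee_fin.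
  apply: le_trans (_ : 2 `^ q * \sum_(m \in A)
      ball_average R alpha x m (N m) `^ q * w m `^ q <= _); last first.
    by rewrite ler_wpM2l ?powR_ge0 // avgD.
  rewrite !fsbig_finite //= mulr_sumr; apply: ler_sum => m _.
  rewrite mulrA /weight_pow ler_pM2r ?powR_gt0 //.
  rewrite -powRM ?ball_average_ge0 // ger0_norm //.
  apply: ge0_ler_powR; rewrite ?nnegrE //; first exact: ltW.
  by rewrite (mulr_ge0 _ (ball_average_ge0 _ _ _ _ _)).
have Gnorm : (lp_norm q (weight_pow w q) G <= (2 * C0 `^ q^-1 * F `^ p^-1)%:E)%E.
  rewrite /lp_norm.
  (* The exponents match because [(q / p) * (1 / q) = 1 / p]. *)
  have -> : 2 * C0 `^ q^-1 * F `^ p^-1 = (2 `^ q * D) `^ q^-1.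
    rewrite powRM ?powR_ge0 // /D powRM ?powR_ge0 // -!powRrM qV.
    by rewrite powRr1 // [q / p * _]mulrAC qV mul1r mulrA.
  rewrite -poweR_EFin; apply: gt0_ler_poweR.
  - by rewrite invr_ge0 ltW.
  - by rewrite in_itv /= leey andbT esum_ge0 // => k _; rewrite lee_fin mulr_ge0 ?powR_ge0.
  - by rewrite in_itv /= leey andbT lee_fin mulr_ge0 ?powR_ge0.
  - exact: Gsum.
split=> //; first by rewrite /lp /=; exact: le_lt_trans Gnorm (ltry _).
apply: le_trans Gnorm _; rewrite /lp_norm -/e eF poweR_EFin -EFinM lee_fin.
by rewrite ler_wpM2r ?powR_ge0.
Qed.
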